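(* For every abelian group $\mathbb{X}$ of (finite) order $n\ge 2$, the finite state wreath power of $\mathbb{X}$ regularly acting on itself contains a subgroup isomorphic to the lamplighter group $\mathbb{X}\wr\mathbb{Z}$.
   Context: Let $\mathsf{X}$ be a finite alphabet with at least two letters and $\mathsf{X}^*$ the set of all finite words over $\mathsf{X}$ (including the empty word $\Lambda$). An automaton over $\mathsf{X}$ is a triple $(Q,\lambda,\mu)$ with a set of states $Q$, transition function $\lambda:Q\times\mathsf{X}\to Q$ and output function $\mu:Q\times\mathsf{X}\to\mathsf{X}$; it is finite if $Q$ is finite. Each state $q\in Q$ defines a transformation $\mu_q:\mathsf{X}^*\to\mathsf{X}^*$ by $\mu_q(\Lambda)=\Lambda$, $\mu_q(xw)=\mu(q,x)\,\mu_{\lambda(q,x)}(w)$; such transformations are called automaton transformations over $\mathsf{X}$, and they form a semigroup $SA(\mathsf{X})$ under composition. For a transformation semigroup $(T,\mathsf{X})$, its finite state wreath power is the subsemigroup of $SA(\mathsf{X})$ consisting of all automaton transformations defined at states of finite automata over $\mathsf{X}$ such that at every state $q$ of the automaton the transformation $x\mapsto\mu(q,x)$ of $\mathsf{X}$ belongs to $T$. Here the alphabet is $\mathbb{X}$ (written additively) and $T$ is the group of permutations $x\mapsto x+i$, $i\in\mathbb{X}$, of the set $\mathbb{X}$ (the regular action). The lamplighter group $\mathbb{X}\wr\mathbb{Z}$ is the restricted wreath product $\left(\bigoplus_{i\in\mathbb{Z}}\mathbb{X}^{(i)}\right)\rtimes\mathbb{Z}$ with $\mathbb{X}^{(i)}\simeq\mathbb{X}$,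 where $\mathbb{Z}$ acts by translations of the index set. *)

(* Defs.v *)
From HB Require Import structures.
From mathcomp Require Import all_boot all_algebra finmap.
From mathcomp Require Import boolp classical_sets functions cardinality.
From mathcomp Require Import monalg.

Set Implicit Arguments.
Unset Strict Implicit.
Unset Printing Implicit Defensive.

Import GRing.Theory.
Local Open Scope classical_set_scope.
Local Open Scope ring_scope.

Record automaton (X : Type) := Automaton {
  state : Type;
  transition : state -> X -> state;
  output : state -> X -> X
}.

Fixpoint state_transformation (X : Type) (A : automaton X) (q : state A)
    (w : seq X) : seq X :=
  if w is x :: w' then
    output q x :: state_transformation (transition q x) w'
  else [::].

(* T is the underlying set of a transformation semigroup on the alphabet X. *)
Definition fs_wreath_power (X : Type) (T : set (X -> X)) :
    set (seq X -> seq X) :=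
  [set f | exists A : automaton X,
    [/\ finite_set [set: state A],
        forall q : state A, T (output q)
      & exists q : state A, f = state_transformation q]].

Definition regular_action (X : zmodType) : set (X -> X) :=
  [set g | exists i : X, g = fun x => x + i].

Section Lamplighter.
Context (X : zmodType).

(* {malg X[int]}, used only as an additive group, is the direct sum of copies *)
(* of X indexed by the integers: X-valued functions with finite support.      *)
Definition lamp_shift (m : int) (f : {malg X[int]}) : {malg X[int]} :=
  [malg k in [fset (i + m)%R | i in msupp f]%fset => f@_(k - m)].

Lemma lamp_shiftE m f k : (lamp_shift m f)@_k = f@_(k - m).
Proof.
rewrite mcoeffE; case: ifPn => // /negP kP.
apply/esym/mcoeff_outdom/negP => kf; apply: kP.
by apply/imfsetP; exists (k - m) => //=; rewrite subrK.
Qed.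

(* A definition rather than a notation, so that it does not inherit the       *)
(* direct product structure of the pair type.                                 *)
Definition lamplighter : Type := ({malg X[int]} * int)%type.

HB.instance Definition _ := Choice.on lamplighter.

Definition lamplighter_mul (a b : lamplighter) : lamplighter :=
  (a.1 + lamp_shift a.2 b.1, a.2 + b.2).

Definition lamplighter_one : lamplighter := (0, 0).

Definition lamplighter_inv (a : lamplighter) : lamplighter :=
  (- lamp_shift (- a.2) a.1, - a.2).

Fact lamplighter_mulA : associative lamplighter_mul.
Proof.
move=> [f m] [g n] [h p]; congr (_, _); rewrite /= ?addrA //.
by apply/malgP => k; rewrite !(mcoeffD, lamp_shiftE) addrA opprD addrA.
Qed.

Fact lamplighter_mul1 : left_id lamplighter_one lamplighter_mul.
Proof.
move=> [f m]; congr (_, _); rewrite /= ?add0r //.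
by apply/malgP => k; rewrite lamp_shiftE subr0.
Qed.

Fact lamplighter_mulr1 : right_id lamplighter_one lamplighter_mul.
Proof.
move=> [f m]; congr (_, _); rewrite /= ?addr0 //.
by apply/malgP => k; rewrite mcoeffD lamp_shiftE mcoeff0 addr0.
Qed.

Fact lamplighter_mulV :
  left_inverse lamplighter_one lamplighter_inv lamplighter_mul.
Proof.
by move=> [f m]; congr (_, _); rewrite /= ?addNr.
Qed.

Fact lamplighter_mulrV :
  right_inverse lamplighter_one lamplighter_inv lamplighter_mul.
Proof.
move=> [f m]; congr (_, _); rewrite /= ?addrN //; apply/malgP => k.
by rewrite mcoeffD lamp_shiftE mcoeffN lamp_shiftE opprK subrK mcoeff0 addrN.
Qed.

HB.instance Definition _ := isGroup.Build lamplighter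
  lamplighter_mulA lamplighter_mul1 lamplighter_mulr1
  lamplighter_mulV lamplighter_mulrV.

End Lamplighter.

Definition transformation_subgroup (W : Type) (S H : set (W -> W)) : Prop :=
  [/\ H `<=` S,
      H idfun,
      forall f g, H f -> H g -> H (f \o g)
    & forall f, H f -> exists2 g, H g & f \o g = idfun /\ g \o f = idfun].

(* phi is an isomorphism from G onto H, taken with composition of maps. *)
Definition transformation_isom (G : groupType) (W : Type) (H : set (W -> W))
    (phi : G -> W -> W) : Prop :=
  (forall a b : G, phi (a * b)%g = phi a \o phi b) /\ set_bij [set: G] H phi.

(* Main.v *)
(** Read a word x_0 x_1 ... as the start of the formal power series
    x_0 + x_1 t + ... with coefficients in X.  Multiplication by 1 + t, its
    inverse, and the addition of a constant c to the first letter are all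
    performed by finite automata whose outputs are translations.  The lamplighter
    element (f, m) acts by x |-> f(1 + t) + (1 + t)^m x.  The action is faithful:
    a nonzero f can be multiplied by a power of 1 + t so that its lowest
    exponent becomes 0, and then the coefficient of f(1 + t) at the top
    exponent is the top coefficient of f. *)
Require Import Defs.
From HB Require Import structures.
From mathcomp Require Import all_boot all_order all_algebra finmap.
From mathcomp Require Import boolp classical_sets functions cardinality.
From mathcomp Require Import monalg.

Set Implicit Arguments.
Unset Strict Implicit.
Unset Printing Implicit Defensive.

Import Order.TTheory GRing.Theory Num.Theory.

(** * Power series over [X] and powers of 1 + t *)

Section PowerSeries.
Local Open Scope ring_scope.
Context (X : zmodType).
Implicit Types (x y : nat -> X) (c q : X) (m k : int) (f g : {malg X[int]}).

(* The letter [q] stands for the coefficient of index -1. *)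
Definition mul1t_from q x (i : nat) : X := x i + (if i is j.+1 then x j else q).

(** Solves (1 + t) y = x for y: here [q] is the coefficient of index -1 of y, not of [x]. *)
Fixpoint div1t_from q x (i : nat) : X :=
  x i - (if i is j.+1 then div1t_from q x j else q).

Definition const_series c (i : nat) : X := if i is 0%N then c else 0.

Lemma mul1tK : cancel (mul1t_from 0) (div1t_from 0).
Proof.
move=> x; apply/funext; elim=> [|i IH].
  by rewrite /= /mul1t_from subr0 addr0.
by rewrite /= IH /mul1t_from addrK.
Qed.

Lemma div1tK : cancel (div1t_from 0) (mul1t_from 0).
Proof. by move=> x; apply/funext; case=> [|i]; rewrite /mul1t_from /= subrK. Qed.

Definition pow1t m : (nat -> X) -> nat -> X :=
  match m with
  | Posz n => iter n (mul1t_from 0)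
  | Negz n => iter n.+1 (div1t_from 0)
  end.

Lemma pow1tS m x : pow1t (m + 1) x = mul1t_from 0 (pow1t m x).
Proof.
case: m => n; first by rewrite -PoszD addn1.
case: n => [|n]; first by rewrite /= div1tK.
have -> : Negz n.+1 + 1 = Negz n.
  by rewrite !NegzE -[n.+2]addn1 PoszD opprD subrK.
by rewrite /= div1tK.
Qed.

Lemma pow1tP m x : pow1t (m - 1) x = div1t_from 0 (pow1t m x).
Proof. by rewrite -{2}(subrK 1 m) pow1tS mul1tK. Qed.

Lemma pow1tD m k x : pow1t (m + k) x = pow1t m (pow1t k x).
Proof.
elim/int_rect: m => [|n IH|n IH]; first by rewrite add0r.
  by rewrite -addn1 PoszD addrAC !pow1tS IH.
by rewrite -addn1 PoszD opprD addrAC !pow1tP IH.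
Qed.

Lemma pow1t_is_zmod_morphism m : zmod_morphism (pow1t m).
Proof.
have mulB : zmod_morphism (mul1t_from 0).
  move=> x y; apply/funext; case=> [|i]; rewrite !fctE /mul1t_from /=.
    by rewrite !addr0.
  by rewrite opprD addrACA.
have iterB h : zmod_morphism h -> forall n : nat, zmod_morphism (iter n h).
  by move=> hB; elim=> // n IH x y; rewrite !iterS IH hB.
case: m => n; apply: iterB => // x y.
(* The inverse of an additive bijection is additive. *)
by rewrite -{1}[x]div1tK -{1}[y]div1tK -mulB mul1tK.
Qed.

HB.instance Definition _ m :=
  GRing.isZmodMorphism.Build (nat -> X) (nat -> X) (pow1t m)
    (pow1t_is_zmod_morphism m).

(** * Evaluation of Laurent polynomials at 1 + t *)

Lemma const_seriesD c q :
  const_series (c + q) = const_series c + const_series q.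
Proof. by apply/funext; case=> [|i]; rewrite fctE /= ?addr0. Qed.

Lemma const_series0 : const_series 0 = 0.
Proof. by apply/funext; case. Qed.

(** Each factor 1 + t moves the top coefficient up by one index and leaves its value unchanged. *)
Lemma pow1t_const_top (n : nat) c :
  pow1t n (const_series c) n = c /\
  forall i, (n < i)%N -> pow1t n (const_series c) i = 0.
Proof.
elim: n => [|n [IHn IHi]]; first by split=> // -[].
rewrite -addn1 PoszD; split=> [|[|i] lt_ni]; rewrite ?addn1 // pow1tS /mul1t_from.
  by rewrite IHi // add0r.
rewrite addn1 ltnS in lt_ni.
by rewrite !IHi ?addr0 // ltnW.
Qed.

(** [X] is only an additive group, so a coefficient enters as a constant series multiplied by a
    power of 1 + t; negative powers are expanded as series. *)
Definition eval1t f : nat -> X :=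
  \sum_(k <- msupp f) pow1t k (const_series f@_k).

(** Terms outside the support vanish, so the sums for several elements can be taken over one index
    set. *)
Lemma eval1tEw f (S : {fset int}) : (msupp f `<=` S)%fset ->
  eval1t f = \sum_(k <- S) pow1t k (const_series f@_k).
Proof.
move=> fS; apply: big_fset_incl => // k _ /mcoeff_outdom ->.
by rewrite const_series0 raddf0.
Qed.

Lemma eval1tD f g : eval1t (f + g) = eval1t f + eval1t g.
Proof.
rewrite (eval1tEw (msuppD_le f g)) (eval1tEw (fsubsetUl (msupp f) (msupp g))).
rewrite (eval1tEw (fsubsetUr (msupp f) (msupp g))) -big_split /=.
by apply: eq_bigr => k _; rewrite mcoeffD const_seriesD raddfD.
Qed.

Lemma eval1tU c m : eval1t << c *g m >> = pow1t m (const_series c).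
Proof. by rewrite (eval1tEw msuppU_le) big_seq_fset1 mcoeffUU. Qed.

(** Reindexing by the translation; this compatibility is what makes [lamp_act] multiplicative. *)
Lemma eval1t_shift m f : eval1t (lamp_shift m f) = pow1t m (eval1t f).
Proof.
have supp : (msupp (lamp_shift m f) `<=` [fset (i + m)%R | i in msupp f])%fset.
  apply/fsubsetP => k; rewrite -mcoeff_neq0 lamp_shiftE mcoeff_neq0 => kf.
  by apply/imfsetP; exists (k - m) => //=; rewrite subrK.
rewrite (eval1tEw supp) big_imfset /=; last by move=> i j _ _ /addIr.
rewrite raddf_sum; apply: eq_bigr => i _.
by rewrite lamp_shiftE addrK addrC pow1tD.
Qed.

Lemma eval1t_eq0 f : eval1t f = 0 -> f = 0.
Proof.
move=> ev0; have [f0|[k0 k0f]] := fset_0Vmem (msupp f).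
  by apply/malgP => k; rewrite mcoeff0 mcoeff_outdom // f0.
case: (arg_maxP (P := predT) (fun k : msupp f => val k) (i0 := [` k0f]%fset))
  => // -[k kf] _ kmax.
case: (arg_minP (P := predT) (fun k : msupp f => val k) (i0 := [` k0f]%fset))
  => // -[l lf] _ lmin.
have ge_l j : j \in msupp f -> exists n : nat, j - l = n.
  move=> jf; have := lmin [` jf]%fset isT; rewrite /= -subr_ge0.
  by case: (j - l) => // n _; exists n.
have [n kl] := ge_l k kf.
(* Multiplying by (1 + t)^(-l) turns each exponent j into j - l >= 0. Only the top one, n = k - l,
   contributes at index n. *)
have : pow1t (- l) (eval1t f) n = 0 by rewrite ev0 raddf0.
rewrite raddf_sum fct_sumE (big_fsetD1 k) //= big1_fset => [|j]; last first.
  rewrite !inE => /andP[jk jf] _; rewrite -pow1tD addrC.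
  have [p jl] := ge_l j jf; rewrite jl.
  have [_ -> //] := pow1t_const_top p f@_j.
  rewrite -ltz_nat -kl -jl ltrD2r lt_neqAle jk /=.
  exact: (kmax [` jf]%fset isT).
rewrite addr0 -pow1tD addrC kl; have [-> _] := pow1t_const_top n f@_k.
by move/eqP; rewrite mcoeff_eq0 kf.
Qed.

Lemma eval1t_inj : injective eval1t.
Proof.
move=> f g fg; apply/eqP; rewrite -subr_eq0; apply/eqP/eval1t_eq0.
apply: (@addIr _ (eval1t g)).
by rewrite -eval1tD subrK add0r.
Qed.

(** * The action of the lamplighter group on series *)

Definition lamp_act (a : lamplighter X) x : nat -> X := eval1t a.1 + pow1t a.2 x.

Lemma lamp_actM (a b : lamplighter X) :
  lamp_act (a * b)%g = lamp_act a \o lamp_act b.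
Proof.
apply/funext => x; rewrite /lamp_act /= eval1tD eval1t_shift pow1tD.
by rewrite raddfD addrA.
Qed.

Lemma lamp_act1 : lamp_act 1%g = idfun.
Proof.
by apply/funext => x; rewrite /lamp_act /= /eval1t msupp0 big_seq_fset0 add0r.
Qed.

(** The image of the zero series recovers the lamps; the constant series [c] then recovers the
    exponent, since (1 + t)^m c is the value of a single monomial and [eval1t] is injective. *)
Lemma lamp_act_inj (c : X) : c != 0 -> injective lamp_act.
Proof.
move=> c0 [f m] [g k] /funeqP E.
have fg : f = g.
  by apply: eval1t_inj; move: (E 0); rewrite /lamp_act !raddf0 !addr0.
congr (_, _) => //; move: (E (const_series c)).
rewrite /lamp_act /= fg => /addrI; rewrite -!eval1tU => /eval1t_inj /malgP /(_ m).
rewrite mcoeffUU mcoeffU; case: eqP => [-> //|_] c_eq0.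
by rewrite c_eq0 eqxx in c0.
Qed.

End PowerSeries.

(** * From causal maps on series to maps on words *)

Section FiniteState.
Local Open Scope classical_set_scope.
Local Open Scope ring_scope.
Context (X : finZmodType).
Implicit Types (x y : nat -> X) (c : X) (w : seq X).
Implicit Types (F G : (nat -> X) -> nat -> X).

Definition causal F : Prop :=
  forall x y n, (forall i, (i <= n)%N -> x i = y i) -> F x n = F y n.

(** The word is padded with zeros to a series; for causal [F] the letters kept do not depend on the
    padding. *)
Definition word_map F w : seq X := mkseq (F (nth 0 w)) (size w).

(** [word_map G] cuts the intermediate series off at the length of the word, and a causal [F] does
    not look beyond. *)
Lemma word_map_comp F G : causal F ->
  word_map (F \o G) = word_map F \o word_map G.
Proof.
move=> Fc; apply/funext => w; rewrite /word_map /= size_mkseq.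
apply/eq_in_map => n; rewrite mem_iota /= => nw.
by apply: Fc => i le_in; rewrite nth_mkseq // (leq_ltn_trans le_in).
Qed.

Lemma word_map_id : word_map idfun = idfun.
Proof. by apply/funext => w; apply: mkseq_nth. Qed.

Lemma word_map_inj F G : causal F -> causal G ->
  word_map F = word_map G -> F = G.
Proof.
move=> Fc Gc /funeqP FG; apply/funext => x; apply/funext => n.
(* Letter n of the image is already visible on the prefix of length n + 1. *)
have nthx H : causal H -> nth 0 (word_map H (mkseq x n.+1)) n = H x n.
  move=> Hc; rewrite /word_map size_mkseq nth_mkseq //.
  by apply: Hc => i le_in; rewrite nth_mkseq.
by rewrite -(nthx F) // FG nthx.
Qed.

(** The two hypotheses are the recursion of [state_transformation] written on series; they reduce
    identifying an automaton to a check on coefficients. *)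
Lemma state_transformation_word_map (A : automaton X)
    (F : state A -> (nat -> X) -> nat -> X) (q : state A) :
    (forall q x, F q x 0%N = output q (x 0%N)) ->
    (forall q x i, F q x i.+1 = F (transition q (x 0%N)) (x \o succn) i) ->
  state_transformation q = word_map (F q).
Proof.
move=> F0 FS; apply/funext => w; elim: w q => //= a w IH q.
rewrite IH /word_map /mkseq /= F0 (iotaDl 1 0) -map_comp.
by congr (_ :: _); apply: eq_map => i; rewrite /= FS.
Qed.

(** * Composition of automata *)

Definition comp_automaton (A B : automaton X) : automaton X :=
  Automaton (fun (q : state A * state B) a =>
               (transition q.1 (output q.2 a), transition q.2 a))
            (fun q a => output q.1 (output q.2 a)).

Lemma state_transformation_comp (A B : automaton X) p q w :
  @state_transformation X (comp_automaton A B) (p, q) w =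
  state_transformation p (state_transformation q w).
Proof. by elim: w p q => //= a w IH p q; rewrite IH. Qed.

Lemma fs_wreath_power_comp (T : set (X -> X)) (s t : seq X -> seq X) :
    (forall g h, T g -> T h -> T (g \o h)) ->
  fs_wreath_power T s -> fs_wreath_power T t -> fs_wreath_power T (s \o t).
Proof.
move=> Tcomp [A [finA TA [p ->]]] [B [finB TB [q ->]]].
exists (comp_automaton A B); split.
- by rewrite -setXTT; apply: finite_setX.
- by move=> [p' q']; apply: Tcomp (TA p') (TB q').
by exists (p, q); apply/funext => w; rewrite state_transformation_comp.
Qed.

Lemma regular_action_comp (g h : X -> X) :
  regular_action g -> regular_action h -> regular_action (g \o h).
Proof.
move=> [i ->] [j ->]; exists (j + i).
by apply/funext => a; rewrite /= addrA.
Qed.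

(** Causality is carried along because [word_map_comp] and [word_map_inj] rely on it. *)
Definition finite_state F : Prop :=
  causal F /\ fs_wreath_power (@regular_action X) (word_map F).

Lemma finite_state_comp F G :
  finite_state F -> finite_state G -> finite_state (F \o G).
Proof.
move=> [Fc Ffs] [Gc Gfs]; split.
  by move=> x y n xy; apply: Fc => i le_in; apply: Gc => j /leq_trans/(_ le_in)/xy.
rewrite word_map_comp //; apply: fs_wreath_power_comp => //.
exact: regular_action_comp.
Qed.

(** * Finite automata for the lamplighter action *)

Lemma finite_state_mul1t : finite_state (mul1t_from (0 : X)).
Proof.
split=> [x y [|n] xy|]; rewrite ?/mul1t_from ?xy //.
(* The state is the previous input letter. *)
pose A := Automaton (fun (_ : X) (a : X) => a) (fun q a => a + q).
exists A; split=> /=.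
- exact: finite_finset.
- by move=> q; exists q.
exists 0.
rewrite (state_transformation_word_map (A := A) (F := @mul1t_from X)) //.
by move=> q x [|i].
Qed.

Lemma finite_state_div1t : finite_state (div1t_from (0 : X)).
Proof.
split=> [x y n|].
  by elim: n => [|n IH] xy /=; rewrite xy // IH // => i /leqW /xy.
(* The state is the previous output letter. *)
pose A := Automaton (fun (q : X) a => a - q) (fun (q : X) a => a - q).
exists A; split=> /=.
- exact: finite_finset.
- by move=> q; exists (- q).
exists 0.
rewrite (state_transformation_word_map (A := A) (F := @div1t_from X)) //.
by move=> q x; elim=> [//|i IH]; rewrite /= -IH.
Qed.

Lemma finite_state_add_const c : finite_state (fun x => const_series c + x).
Proof.
split=> [x y n xy|]; first by rewrite !fctE xy.
(* The state [true] marks the first letter. *)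
pose A := Automaton (fun (_ : bool) _ => false)
                    (fun q a => a + (if q then c else 0)).
exists A; split=> /=.
- exact: finite_finset.
- by move=> q; exists (if q then c else 0).
exists true; rewrite (state_transformation_word_map
  (A := A) (F := fun q x => const_series (if q then c else 0) + x)) //=.
- by move=> q x; rewrite fctE addrC.
- by move=> q x [|i]; rewrite !fctE.
Qed.

Lemma finite_state_pow1t m : finite_state (@pow1t X m).
Proof.
have iterF F : finite_state F -> forall n : nat, finite_state (iter n.+1 F).
  by move=> Ffs; elim=> // n IH; apply: (finite_state_comp Ffs IH).
case: m => [[|n]|n]; [|exact: (iterF _ finite_state_mul1t)
                      |exact: (iterF _ finite_state_div1t)].
(* [iterF] starts at one iteration, so the identity is written as 1 + t times its inverse. *)
have -> : pow1t 0%N = @mul1t_from X 0 \o div1t_from 0.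
  by apply/funext => x; rewrite /= div1tK.
exact: finite_state_comp finite_state_mul1t finite_state_div1t.
Qed.

Lemma finite_state_add_eval1t (f : {malg X[int]}) :
  finite_state (fun x => eval1t f + x).
Proof.
rewrite /eval1t; apply: (big_ind (fun s => finite_state (fun x => s + x))).
- rewrite -const_series0; exact: finite_state_add_const.
- move=> s t sfs tfs; have := finite_state_comp sfs tfs.
  by congr finite_state; apply/funext => x; rewrite /= addrA.
(* Adding (1 + t)^k c is the conjugate, by multiplication by (1 + t)^k, of adding c. *)
move=> k _; have := finite_state_comp (finite_state_pow1t k)
  (finite_state_comp (finite_state_add_const f@_k) (finite_state_pow1t (- k))).
congr finite_state; apply/funext => x.
by rewrite /= raddfD /= -pow1tD subrr.
Qed.

Lemma finite_state_lamp_act (a : lamplighter X) : finite_state (lamp_act a).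
Proof.
exact: finite_state_comp (finite_state_add_eval1t a.1) (finite_state_pow1t a.2).
Qed.

End FiniteState.

(** * The subgroup isomorphic to the lamplighter group *)

Theorem corollary3 (X : finZmodType) (n : nat) (hX : #|X| = n) (hn : 2 <= n) :
  exists H : set (seq X -> seq X),
    transformation_subgroup (fs_wreath_power (@regular_action X)) H /\
    exists phi : lamplighter X -> seq X -> seq X, transformation_isom H phi.
Proof.
pose phi (a : lamplighter X) := word_map (lamp_act a).
have phiM a b : phi (a * b)%g = phi a \o phi b.
  rewrite /phi lamp_actM word_map_comp //.
  by have [] := finite_state_lamp_act a.
have phi1 : phi 1%g = idfun by rewrite /phi lamp_act1 word_map_id.
(* A nonzero letter separates the powers of 1 + t in [lamp_act_inj]. *)
have [c c0] : exists c : X, c != 0%R.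
  have /card_gt0P[c] : 0 < #|predC1 (0%R : X)|.
    by rewrite cardC1 hX -subn1 subn_gt0.
  by rewrite !inE => c0; exists c.
exists (range phi); split; last first.
  exists phi; split=> //; split; [by move=> a _; exists a| |by []].
  move=> a b _ _ /word_map_inj E; apply: (lamp_act_inj c0).
  by apply: E; [have [] := finite_state_lamp_act a
               |have [] := finite_state_lamp_act b].
split.
- by move=> _ [a _ <-]; have [] := finite_state_lamp_act a.
- by exists 1%g.
- by move=> _ _ [a _ <-] [b _ <-]; exists (a * b)%g.
- move=> _ [a _ <-]; exists (phi a^-1%g); first by exists a^-1%g.
  by rewrite -!phiM mulgV mulVg.
Qed.
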